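(* Let $p\in(0,1)$ be fixed. With high probability, $$ \mathrm{sat}\left(G\left(n,p\right),C_4\right)\leqslant \frac{3(1+(1-p)^3)}{2(1-(1-p)^3)}n(1+o(1)) $$ when $p>1-1/\sqrt[3]{7}$, and $$ \mathrm{sat}\left(G\left(n,p\right),C_4\right)\leqslant \left(\frac{s+1}{2}+s(1-p)^s+\frac{s(1-p)^{2s}}{1-(1-p)^s}\right)n(1+o(1)) $$ when $p\leqslant1-1/\sqrt[3]{7}$, where $s$ is the minimum positive integer such that $(2s^2+1)(1-p)^s < 1$.
   Context: $G(n,p)$ is the binomial random graph on vertex set $[n]$ in which each pair of vertices is adjacent independently with probability $p$. A property holds with high probability if its probability tends to $1$ as $n\to\infty$; $o(1)$ denotes a function of $n$ tending to $0$. $C_4$ is the cycle on $4$ vertices. For graphs $F,G$, a spanning subgraph $H\subseteq G$ is $F$-saturated in $G$ if $H$ contains no copy of $F$ but adding to $H$ any edge of $G$ not in $H$ creates a copy of $F$; $\mathrm{sat}(G,F)$ is the minimum number of edges of an $F$-saturated graph in $G$. *)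

(* Defs.v *)
From HB Require Import structures.
From mathcomp Require Import all_boot all_order all_algebra.
From mathcomp Require Import all_classical all_reals all_analysis.
Set Implicit Arguments. Unset Strict Implicit. Unset Printing Implicit Defensive.
Import Order.TTheory GRing.Theory Num.Theory.

(* Graphs on vertex set 'I_n are represented by their edge sets:
   an edge {u,v} is stored as the ordered pair (u,v) with u < v. *)
Definition pairs (n : nat) : {set 'I_n * 'I_n} := [set e : 'I_n * 'I_n | (e.1 < e.2)%N].

Definition adj n (E : {set 'I_n * 'I_n}) (u v : 'I_n) : bool :=
  ((u, v) \in E) || ((v, u) \in E).

Definition has_C4 n (E : {set 'I_n * 'I_n}) : bool :=
  [exists a, exists b, exists c, exists d,
    uniq [:: a; b; c; d] &&
    [&& adj E a b, adj E b c, adj E c d & adj E d a]].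

Definition C4_saturated n (G H : {set 'I_n * 'I_n}) : bool :=
  [&& H \subset G, ~~ has_C4 H &
      [forall e in G :\: H, has_C4 (e |: H)]].

(* sat(G, C4): minimum number of edges of a C4-saturated graph in G
   (a saturated graph always exists and has at most #|G| edges). *)
Definition satC4 n (G : {set 'I_n * 'I_n}) : nat :=
  \big[minn/#|G|]_(H : {set 'I_n * 'I_n} | C4_saturated G H) #|H|.

Local Open Scope ring_scope.

Definition PrGnp (R : realType) (p : R) (n : nat)
    (A : {set 'I_n * 'I_n} -> bool) : R :=
  \sum_(E : {set 'I_n * 'I_n} | (E \subset pairs n) && A E)
     p ^+ #|E| * (1 - p) ^+ (#|pairs n| - #|E|)%N.

(* Main.v *)
Require Import Defs.
From HB Require Import structures.
From mathcomp Require Import all_boot all_order all_algebra.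
From mathcomp Require Import reals zify ring lra.
Set Implicit Arguments. Unset Strict Implicit. Unset Printing Implicit Defensive.
Import Order.TTheory GRing.Theory Num.Theory.

(** Put [q = 1 - p].  Suppose [G] contains disjoint triangles [T_0, ..., T_(m-1)] inside a small
    vertex set [V0], and join every vertex outside [V0] to one vertex (its parent) of the first
    triangle it sees in [G].  This graph is C4-free.  Let [H] be any C4-saturated graph of [G]
    containing it.  A vertex has at most one [H]-neighbour among the children of a given parent
    (other than itself), and children of distinct vertices of the same triangle are not adjacent
    in [H].  Charging each edge to its endpoint of higher level, a vertex whose parent lies in
    [T_k] pays at most [1 + 1/2 + 3k], so up to terms depending only on [m] and [V0],
    [sat(G, C4) <= sum over v of (3/2 + 3 k(v))].

    In [G(n,p)] we reserve [3 m^2] vertices, split them into [m] blocks of [m] triples, and take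
    for [T_b] a triple of block [b] spanning a triangle; with [m ~ n^(1/5)] every block has one whp.
    The edges leaving [V0] are independent of this choice, so the levels [k(v)] are independent
    truncated geometric variables of mean at most [q^3 / (1 - q^3)], every vertex sees some
    triangle, and Chebyshev's inequality yields
    [sat <= (3/2 + 3 q^3 / (1 - q^3)) n (1 + o(1))] for every [p] in (0,1).  This is the first
    bound.  It is below the second one because [(2 s^2 + 1) q^s < 1] and [q^3 >= 1/7] force
    [s p >= 2], while [1 + 3 q^3 / (1 - q^3) <= 1 / p <= s / 2]. *)

(** * Counting edges of C4-saturated graphs *)

Lemma adj_sym n (E : {set 'I_n * 'I_n}) u v : adj E u v = adj E v u.
Proof. by rewrite /adj orbC. Qed.

Lemma adjS n (E F : {set 'I_n * 'I_n}) u v : E \subset F -> adj E u v -> adj F u v.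
Proof. by move=> /subsetP sEF /orP[] /sEF h; rewrite /adj h ?orbT. Qed.

Lemma adj_neq n (E : {set 'I_n * 'I_n}) u v : E \subset pairs n -> adj E u v -> u != v.
Proof.
move=> /subsetP sE; apply: contraTneq => <-; rewrite /adj orbb.
by apply: (contraNN (sE _)); rewrite inE ltnn.
Qed.

Definition edge n (u v : 'I_n) : 'I_n * 'I_n := if (u < v)%N then (u, v) else (v, u).

Lemma adjE n (E : {set 'I_n * 'I_n}) u v : E \subset pairs n ->
  adj E u v = (edge u v \in E).
Proof.
move=> /subsetP sE; rewrite /adj /edge.
have nE (a b : 'I_n) : ~~ (a < b)%N -> (a, b) \in E = false.
  by move=> nab; apply/negbTE; apply: (contraNN (sE _)); rewrite inE.
case: ifP => uv; last by rewrite nE ?uv.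
by rewrite [(v, u) \in E]nE ?orbF // -leqNgt ltnW.
Qed.

Lemma edge_pairs n (u v : 'I_n) : u != v -> edge u v \in pairs n.
Proof.
rewrite /edge inE => uv; case: ifP => //= /negbT; rewrite -leqNgt.
by rewrite leq_eqVlt eq_sym (inj_eq val_inj) (negbTE uv).
Qed.

Lemma edge_eq n (u v u' v' : 'I_n) : edge u v = edge u' v' ->
  (u = u' /\ v = v') \/ (u = v' /\ v = u').
Proof. by rewrite /edge; case: ifP => _; case: ifP => _ [-> ->]; auto. Qed.

(** Otherwise [a], [b], [c], [d] would span a 4-cycle: consecutive vertices differ because there are
    no loops, so only the two diagonals have to be separated. *)
Lemma C4_free_codegree n (H : {set 'I_n * 'I_n}) a b c d :
  H \subset pairs n -> ~~ has_C4 H -> adj H a b -> adj H b c -> adj H c d -> adj H d a ->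
  a != c -> b = d.
Proof.
move=> sH nC ab bc cd da ac; apply/eqP; apply: contraNT nC => bd.
have nE := adj_neq sH.
apply/existsP; exists a; apply/existsP; exists b; apply/existsP; exists c.
apply/existsP; exists d; rewrite ab bc cd da /= !inE !negb_or !andbT ac bd.
by rewrite (nE _ _ ab) (nE _ _ bc) (nE _ _ cd) eq_sym (nE _ _ da).
Qed.

Lemma satC4_le n (G H : {set 'I_n * 'I_n}) : C4_saturated G H -> (satC4 G <= #|H|)%N.
Proof.
move=> satH; rewrite /satC4; have := mem_index_enum H.
elim: (index_enum _) => //= A s IHs; rewrite big_cons inE => /predU1P[<-|/IHs Hs].
  by rewrite satH geq_minl.
by case: ifP => // _; apply: leq_trans (geq_minr _ _) Hs.
Qed.

(** An inclusion-maximal C4-free graph between [H0] and [G] is saturated, since each further edge of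
    [G] would contradict maximality. *)
Lemma C4_saturated_extension n (G H0 : {set 'I_n * 'I_n}) : H0 \subset G -> ~~ has_C4 H0 ->
  exists2 H, C4_saturated G H & H0 \subset H.
Proof.
move=> sH0 nC0.
have [|H /maxsetP[/andP[sH nC] maxH] sH0H] :=
  @maxset_exists _ (fun H => (H \subset G) && ~~ has_C4 H) H0; first by rewrite sH0.
exists H => //; apply/and3P; split=> //; apply/forallP => e; apply/implyP.
rewrite inE => /andP[eH eG]; apply: contraNT eH => nCe.
by rewrite -(maxH (e |: H)) ?setU11 ?subsetUr ?nCe ?andbT // subUset sub1set eG.
Qed.

Lemma double_card_edges n (H : {set 'I_n * 'I_n}) : H \subset pairs n ->
  (\sum_u \sum_v adj H u v = 2 * #|H|)%N.
Proof.
move=> sH; rewrite mul2n -addnn pair_big /=.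
rewrite (eq_bigr (fun e : 'I_n * 'I_n => (e \in H) + ((e.2, e.1) \in H))%N) => [|[u v] _ /=].
  have cardE : (\sum_(e : 'I_n * 'I_n) (e \in H) = #|H|)%N.
    by rewrite -sum1_card [RHS]big_mkcond; apply: eq_bigr => e _; case: (e \in H).
  rewrite big_split /= cardE; congr (_ + _)%N.
  rewrite (reindex (fun e : 'I_n * 'I_n => (e.2, e.1))) /=.
    by rewrite -[RHS]cardE; apply: eq_bigr => -[].
  by exists (fun e => (e.2, e.1)) => -[].
rewrite /adj; case uv: ((u, v) \in H); case vu: ((v, u) \in H) => //=.
move/subsetP: sH => sH; move: (sH _ uv) (sH _ vu); rewrite !inE /=.
by move=> /ltnW; rewrite leqNgt => /negbTE ->.
Qed.

Lemma card_ltn_fst m l k : (k <= m)%N -> #|[set i : 'I_m * 'I_l | (i.1 < k)%N]| = (k * l)%N.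
Proof.
move=> km.
have -> : [set i : 'I_m * 'I_l | (i.1 < k)%N] = setX [set b : 'I_m | (b < k)%N] [set: 'I_l].
  by apply/setP => i; rewrite !inE andbT.
rewrite cardsX cardsT card_ord; congr (_ * _)%N.
rewrite -sum1dep_card -(big_mkord (fun i => i < k)%N (fun=> 1%N)).
by rewrite -(big_nat_widen 0 k m predT) // sum_nat_const_nat subn0 muln1.
Qed.

(** * Deterministic bound from disjoint triangles and a parent map *)

Section CoreTriangles.
Variables (n m : nat) (G : {set 'I_n * 'I_n}) (V0 : {set 'I_n}).
Variables (t : 'I_m * 'I_3 -> 'I_n) (par : 'I_n -> 'I_m * 'I_3).
Hypotheses (sG : G \subset pairs n) (t_inj : injective t) (tV0 : forall i, t i \in V0).
Hypothesis tG : forall b a a', a != a' -> adj G (t (b, a)) (t (b, a')).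
Hypothesis parG : forall v, v \notin V0 -> adj G v (t (par v)).

Let core u v := [exists b, exists a, exists a', [&& a != a', u == t (b, a) & v == t (b, a')]].
Let parent u v := (u \notin V0) && (v == t (par u)).
Let base u v := [|| core u v, parent u v | parent v u].

Let core_sym u v : core u v -> core v u.
Proof.
move=> /existsP[b /existsP[a /existsP[a' /and3P[aa' ua va']]]].
apply/existsP; exists b; apply/existsP; exists a'; apply/existsP; exists a.
by rewrite eq_sym aa' ua va'.
Qed.

Let base_sym u v : base u v -> base v u.
Proof.
by rewrite /base => /or3P[/core_sym-> | -> | ->]; rewrite ?orbT.
Qed.

(** The triangles, with one pendant edge from each vertex outside [V0] to its parent. *)
Let H0 := [set e in pairs n | base e.1 e.2].

Let H0_base u v : adj H0 u v -> base u v.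
Proof. by rewrite /adj !inE /= => /orP[/andP[_]|/andP[_ /base_sym]]. Qed.

Let base_H0 u v : u != v -> base u v -> adj H0 u v.
Proof.
move=> uv buv; have := edge_pairs uv.
rewrite /adj /edge !inE /=; case: ifP => //= _ vu; first by rewrite buv.
by rewrite vu (base_sym buv) ?orbT.
Qed.

Let H0_sub : H0 \subset G.
Proof.
apply/subsetP => -[u v]; rewrite inE /= => /andP[uv].
have uvG : adj G u v -> (u, v) \in G.
  by rewrite adjE // /edge; move: uv; rewrite inE /= => ->.
move=> /or3P[/existsP[b /existsP[a /existsP[a' /and3P[aa' /eqP ua /eqP va']]]]||].
- by apply: uvG; rewrite ua va' tG.
- by move=> /andP[uV /eqP vE]; apply: uvG; rewrite vE parG.
- by move=> /andP[vV /eqP uE]; apply: uvG; rewrite adj_sym uE parG.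
Qed.

Let H0_out u v : u \notin V0 -> adj H0 u v -> v = t (par u).
Proof.
move=> uV /H0_base/or3P[/existsP[b /existsP[a /existsP[a' /and3P[_ /eqP uE _]]]]||].
- by rewrite uE tV0 in uV.
- by move=> /andP[_ /eqP].
- by move=> /andP[_ /eqP uE]; rewrite uE tV0 in uV.
Qed.

Let H0_in b a v : v \in V0 -> adj H0 (t (b, a)) v -> exists a', v = t (b, a').
Proof.
move=> vV /H0_base/or3P[/existsP[b' /existsP[a0 /existsP[a' /and3P[_ /eqP uE /eqP vE]]]]||].
- by exists a'; rewrite vE; case: (t_inj uE) => -> _.
- by rewrite /parent tV0.
- by rewrite /parent vV.
Qed.

Let H0_core u v : u \in V0 -> v \in V0 -> adj H0 u v -> exists b a, u = t (b, a).
Proof.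
move=> uV vV /H0_base; rewrite /base /parent uV vV /= orbF.
by move=> /existsP[b /existsP[a /existsP[a' /and3P[_ /eqP -> _]]]]; exists b, a.
Qed.

(** A vertex outside [V0] has degree at most one, so a 4-cycle lies inside [V0]. There all edges
    stay within one triangle, which has too few vertices. *)
Let H0_C4_free : ~~ has_C4 H0.
Proof.
apply/negP => /existsP[u /existsP[v /existsP[w /existsP[z]]]].
move=> /andP[uq /and4P[uv vw wz zu]].
have deg1 (x y y' : 'I_n) : y != y' -> adj H0 x y -> adj H0 x y' -> x \in V0.
  by move=> yy' xy xy'; apply: contraNT yy' => xV; rewrite (H0_out xV xy) (H0_out xV xy').
have sym := adj_sym H0.
have [vz uw] : v != z /\ u != w.
  by move: uq; rewrite /= !inE !negb_or !andbT => /and3P[/and3P[_ -> _] /andP[_ ->] _].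
have uV : u \in V0 by apply: (deg1 _ v z); rewrite // sym.
have vV : v \in V0 by apply: (deg1 _ u w); rewrite // sym.
have wV : w \in V0 by apply: (deg1 _ v z); rewrite // sym.
have zV : z \in V0 by apply: (deg1 _ u w); rewrite // sym.
have [b [a0 uE]] := H0_core uV vV uv.
move: uv; rewrite uE => /(H0_in vV)[a1 vE].
move: vw; rewrite vE => /(H0_in wV)[a2 wE].
move: wz; rewrite wE => /(H0_in zV)[a3 zE].
have : uniq (map (fun a => t (b, a)) [:: a0; a1; a2; a3]) by rewrite /= -uE -vE -wE -zE.
move=> /map_uniq/card_uniqP cE.
by have := max_card (mem [:: a0; a1; a2; a3]); rewrite cE card_ord.
Qed.

Section Count.
Variable H : {set 'I_n * 'I_n}.
Hypotheses (sH : H \subset pairs n) (nC : ~~ has_C4 H) (sH0 : H0 \subset H).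

Let adj_par v : v \notin V0 -> adj H v (t (par v)).
Proof.
move=> vV; apply: (adjS sH0); apply: base_H0; last by rewrite /base /parent vV eqxx orbT.
by apply: contraNneq vV => ->.
Qed.

Let adj_t b a a' : a != a' -> adj H (t (b, a)) (t (b, a')).
Proof.
move=> aa'; apply: (adjS sH0); apply: base_H0; first by rewrite (inj_eq t_inj) xpair_eqE eqxx.
apply/orP; left; apply/existsP; exists b; apply/existsP; exists a; apply/existsP; exists a'.
by rewrite aa' !eqxx.
Qed.

(* Two neighbours of [x] with the same parent [c != x] close a 4-cycle through [c]. *)
Let card_nbrs x (P : pred 'I_n) (Q : {set 'I_m * 'I_3}) :
  (forall w, P w -> [/\ w \notin V0, adj H x w, t (par w) != x & par w \in Q]) ->
  (\sum_(w | P w) 1 <= #|Q|)%N.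
Proof.
move=> hP; rewrite sum1dep_card -(card_in_imset (f := par)).
  by apply/subset_leq_card/subsetP => c /imsetP[w]; rewrite inE => /hP[_ _ _ wQ] ->.
move=> w w'; rewrite !inE => /hP[wV xw wx _] /hP[wV' xw' _ _] E.
apply: (C4_free_codegree (a := x) (c := t (par w)) sH nC) => //; last by rewrite eq_sym.
- by apply: adj_par.
- by rewrite E adj_sym adj_par.
- by rewrite adj_sym.
Qed.

Let lvl v : nat := (par v).1.

(** For fixed [u], the neighbours [w] whose parent is not [u] number at most one per possible
    parent, hence [m * 3]. Those whose parent is [u] contribute at most [n] over all [u], as each
    [w] has one parent. *)
Let out_in : (\sum_(u in V0) \sum_(w | w \notin V0) adj H u w <= #|V0| * (m * 3) + n)%N.
Proof.
apply: (@leq_trans (\sum_(u in V0) (m * 3 + \sum_(w | w \notin V0) (t (par w) == u)))%N).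
  apply: leq_sum => u uV.
  have -> : (m * 3 = #|[set: 'I_m * 'I_3]|)%N by rewrite cardsT card_prod !card_ord.
  have cnt := @card_nbrs u (fun w => [&& w \notin V0, adj H u w & t (par w) != u])
    [set: 'I_m * 'I_3] _.
  apply: leq_trans (leq_add (cnt _) (leqnn _)); last first.
    by move=> w /and3P[wV uw pw]; split; rewrite ?in_setT.
  rewrite [X in (_ <= X + _)%N]big_mkcondr /= -big_split /=.
  by apply: leq_sum => w _; case: (adj H u w) => //=; case: eqP.
rewrite big_split /= sum_nat_const leq_add2l exchange_big /=.
apply: (@leq_trans (\sum_(w : 'I_n) 1)); last by rewrite sum1_card card_ord.
rewrite big_mkcond; apply: leq_sum => w _; case: ifP => // _.
by rewrite (bigD1 (t (par w))) //= eqxx big1 ?addn0 // => u /andP[_]; rewrite eq_sym => /negbTE ->.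
Qed.

(** The parent of a lower neighbour lies in one of the first [lvl u] triangles, and each such vertex
    is the parent of at most one neighbour of [u]. *)
Let lower u : u \notin V0 ->
  (\sum_(w | w \notin V0) (adj H u w && (lvl w < lvl u)) <= lvl u * 3)%N.
Proof.
move=> uV.
have <- : #|[set i : 'I_m * 'I_3 | (i.1 < lvl u)%N]| = (lvl u * 3)%N.
  by apply: card_ltn_fst; apply: ltnW; apply: ltn_ord.
rewrite -big_mkcondr /=; apply: (card_nbrs (x := u)) => w /and3P[wV uw lw]; split=> //.
  by apply: contraNneq uV => <-.
by rewrite inE.
Qed.

(** If [w] had another parent in the same triangle, then [u], [w] and their two adjacent parents
    would form a 4-cycle. So [w] shares the parent of [u], and at most one neighbour does. *)
Let same u : u \notin V0 ->
  (\sum_(w | w \notin V0) (adj H u w && (lvl w == lvl u)) <= 1)%N.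
Proof.
move=> uV; rewrite -(cards1 (par u)).
rewrite -big_mkcondr /=; apply: (card_nbrs (x := u)) => w /and3P[wV uw lw]; split=> //.
  by apply: contraNneq uV => <-.
rewrite inE; apply: contraTT uw => pne; apply/negP => uw.
have ptE : forall v, par v = ((par v).1, (par v).2) by move=> v; case: (par v).
have lE : (par w).1 = (par u).1 by apply/val_inj/eqP.
have adjp : adj H (t (par w)) (t (par u)).
  rewrite ptE (ptE u) lE; apply: adj_t.
  by apply: contraNneq pne => E; rewrite ptE (ptE u) lE E.
have := C4_free_codegree sH nC uw (adj_par wV) adjp; rewrite adj_sym => /(_ (adj_par uV)).
move=> E; move: wV; rewrite E ?tV0 //.
by apply: contraNneq uV => ->.
Qed.

Let out_out : (\sum_(u | u \notin V0) \sum_(w | w \notin V0) adj H u w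
  <= 2 * (\sum_(u | u \notin V0) lvl u * 3) + n)%N.
Proof.
(* Ordered pairs are split by comparing levels; by symmetry the descending and ascending pairs are
   equally many. *)
have -> : (\sum_(u | u \notin V0) \sum_(w | w \notin V0) adj H u w =
  2 * (\sum_(u | u \notin V0) \sum_(w | w \notin V0) (adj H u w && (lvl w < lvl u)))
  + \sum_(u | u \notin V0) \sum_(w | w \notin V0) (adj H u w && (lvl w == lvl u)))%N.
  rewrite mul2n -addnn [X in (_ = _ + X + _)%N]exchange_big /= -!big_split /=; apply: eq_bigr => u _.
  rewrite -!big_split /=; apply: eq_bigr => w _; rewrite (adj_sym H w u).
  by case: (adj H u w) => //=; case: ltngtP.
apply: leq_add; first by rewrite leq_mul2l; apply/orP; right; apply: leq_sum => u; apply: lower.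
apply: (@leq_trans (\sum_(w : 'I_n) 1)); last by rewrite sum1_card card_ord.
by rewrite big_mkcond; apply: leq_sum => u _; case: ifP => // /same.
Qed.

(** Mixed pairs occur in both orders, so [out_in] counts twice; its [2 * n] and the [n] of [out_out]
    make [3 * n]. *)
Lemma card_core_extension :
  (2 * #|H| <= #|V0| ^ 2 + 6 * m * #|V0| + 3 * n + 6 * \sum_(u | u \notin V0) lvl u)%N.
Proof.
rewrite -double_card_edges // (bigID (mem V0)) /=.
under eq_bigr => u _ do rewrite (bigID (mem V0)) /=.
under [X in (_ + X <= _)%N]eq_bigr => u _ do rewrite (bigID (mem V0)) /=.
rewrite !big_split /=.
have inin : (\sum_(u in V0) \sum_(w in V0) adj H u w <= #|V0| ^ 2)%N.
  rewrite -mulnn; apply: (@leq_trans (\sum_(u in V0) #|V0|)); last by rewrite sum_nat_const.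
  apply: leq_sum => u _; rewrite -sum1_card; apply: leq_sum => w _; exact: leq_b1.
have -> : (\sum_(u | u \notin V0) \sum_(w in V0) adj H u w =
   \sum_(u in V0) \sum_(w | w \notin V0) adj H u w)%N.
  by rewrite exchange_big; do 2!apply: eq_bigr => ? _; rewrite adj_sym.
move: inin out_in out_out; rewrite -big_distrl /=.
have -> : (#|V0| * (m * 3) = 3 * (#|V0| * m))%N by lia.
have -> : (6 * m * #|V0| = 6 * (#|V0| * m))%N by lia.
move: (_ ^ 2)%N (#|V0| * m)%N (\sum_(u in V0) \sum_(w in V0) _)%N (\sum_(u | _) lvl u)%N.
move: (\sum_(u in V0) \sum_(w | w \notin V0) adj H u w)%N.
move: (\sum_(u | u \notin V0) \sum_(w | w \notin V0) adj H u w)%N => x y z c k l h1 h2 h3.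
lia.
Qed.

End Count.

Lemma satC4_core_bound :
  (2 * satC4 G <= #|V0| ^ 2 + 6 * m * #|V0| + 3 * n + 6 * \sum_(u | u \notin V0) (par u).1)%N.
Proof.
have [H satH sH0] := C4_saturated_extension H0_sub H0_C4_free.
apply: leq_trans (leq_mul (leqnn 2) (satC4_le satH)) _.
case/and3P: satH => sHG nC _; exact: (card_core_extension (subset_trans sHG sG) nC sH0).
Qed.

End CoreTriangles.

Local Open Scope ring_scope.

(** * Random subsets of a finite set *)

Section RandomSubset.
Variables (R : realFieldType) (T : finType) (D : {set T}) (p : R).
Local Notation q := (1 - p).
Implicit Types (f g : {set T} -> R) (E S : {set T}).

Definition weight E : R := p ^+ #|E| * q ^+ (#|D| - #|E|)%N.

Definition expect f : R := \sum_(E : {set T} | E \subset D) f E * weight E.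

(** Independence in deterministic form: iterating over elements of [S], the value of [f] depends
    only on [E :\: S]. *)
Definition independent (A : Type) (f : {set T} -> A) S := forall e E, e \in S -> f (e |: E) = f E.

Lemma weight_ge0 E : 0 <= p -> p <= 1 -> 0 <= weight E.
Proof. by move=> p0 p1; rewrite mulr_ge0 // exprn_ge0 // subr_ge0. Qed.

Lemma eq_expect f g : f =1 g -> expect f = expect g.
Proof. by move=> fg; apply: eq_bigr => E _; rewrite fg. Qed.

Lemma le_expect f g : 0 <= p -> p <= 1 -> (forall E, E \subset D -> f E <= g E) -> expect f <= expect g.
Proof. by move=> p0 p1 fg; apply: ler_sum => E sE; rewrite ler_wpM2r ?weight_ge0 ?fg. Qed.

Lemma expectD f g : expect (fun E => f E + g E) = expect f + expect g.
Proof. by rewrite -big_split; apply: eq_bigr => E _; rewrite mulrDl. Qed.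

Lemma expectZ c f : expect (fun E => c * f E) = c * expect f.
Proof. by rewrite /expect big_distrr /=; apply: eq_bigr => E _; rewrite mulrA. Qed.

Lemma expectB f g : expect (fun E => f E - g E) = expect f - expect g.
Proof.
rewrite (eq_expect (g := fun E => f E + -1 * g E)) => [|E]; last by rewrite mulN1r.
by rewrite expectD expectZ mulN1r.
Qed.

Lemma expect_sum (I : Type) (r : seq I) (P : pred I) (F : I -> {set T} -> R) :
  expect (fun E => \sum_(i <- r | P i) F i E) = \sum_(i <- r | P i) expect (F i).
Proof. by rewrite /expect exchange_big /=; apply: eq_bigr => E _; rewrite big_distrl. Qed.

(** Grouping the subsets by size turns the sum of weights into the binomial expansion of
    [(p + q) ^+ #|D|]. *)
Lemma expect1 : expect (fun=> 1) = 1.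
Proof.
rewrite /expect (partition_big (fun E => inord #|E| : 'I_#|D|.+1) predT) //=.
transitivity ((p + q) ^+ #|D|); last by rewrite addrCA subrr addr0 expr1n.
rewrite addrC exprDn; apply: eq_bigr => k _.
have kE E : E \subset D -> (inord #|E| == k) = (#|E| == k :> nat).
  by move=> /subset_leq_card le; rewrite -(inj_eq val_inj) /= inordK // ltnS.
rewrite -cards_draws -sumr_const; apply: eq_big => [E|E /andP[sE]].
  by rewrite inE; case sE: (E \subset D) => //=; rewrite kE.
by rewrite kE // => /eqP cE; rewrite mul1r /weight cE mulrC.
Qed.

(** Pair each [E] avoiding [e] with [e |: E]: [f] agrees on both, and [weight E] is the fraction [q]
    of their joint weight. *)
Lemma expect_absent1 f e : e \in D -> independent f [set e] ->
  expect (fun E => f E * (e \notin E)%:R) = q * expect f.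
Proof.
move=> eD indf; rewrite /expect [in RHS](bigID (fun E => e \in E)) /=.
rewrite [X in q * (X + _)](reindex_onto (fun E => e |: E) (fun E => E :\ e)) /=; last first.
  by move=> E /andP[_ eE]; rewrite setD1K.
rewrite [LHS](bigID (fun E => e \in E)) /= big1 => [|E /andP[_ ->]]; last by rewrite mulr0 mul0r.
rewrite add0r [X in q * (X + _)](eq_bigl (fun E => (E \subset D) && (e \notin E))); last first.
  move=> E; rewrite subUset sub1set eD setU11 /= andbT.
  have [eE|eE] /= := boolP (e \in E); last by rewrite setU1K ?eqxx.
  rewrite andbF; apply/negbTE; rewrite negb_and; apply/orP; right.
  by apply: contraTneq eE => <-; rewrite setD11.
rewrite -big_split big_distrr; apply: eq_bigr => E /andP[sE eE] /=.
rewrite (indf e E) ?set11 // eE mulr1 /weight cardsU1 eE add1n.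
have lt : (#|E| < #|D|)%N by apply: proper_card; apply/properP; split=> //; exists e.
have -> : (#|D| - #|E|)%N = (#|D| - #|E|.+1).+1 by lia.
rewrite !exprS; ring.
Qed.

Lemma disjoints_setU (A B E : {set T}) :
  [disjoint A :|: B & E] = [disjoint A & E] && [disjoint B & E].
Proof. by rewrite -!setI_eq0 setIUl setU_eq0. Qed.

Lemma independent_absent S S' : [disjoint S & S'] ->
  independent (fun E => [disjoint S' & E]) S.
Proof.
move=> dS e E eS /=; rewrite -!setI_eq0 setIUr (_ : S' :&: [set e] = set0) ?set0U //.
apply/eqP; rewrite setI_eq0 disjoint_sym disjoints1; apply/negP => eS'.
by move: dS; rewrite -setI_eq0 => /eqP/setP/(_ e); rewrite !inE eS eS'.
Qed.

Lemma independent_present S S' : [disjoint S & S'] ->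
  independent (fun E => S' \subset E) S.
Proof.
move=> dS e E eS /=; apply/idP/idP; last by move=> h; apply: subset_trans h (subsetUr _ _).
move=> /subsetP h; apply/subsetP => x xS; have := h _ xS; rewrite !inE => /predU1P[xe|//].
by move: dS; rewrite -setI_eq0 => /eqP/setP/(_ e); rewrite !inE eS -xe xS.
Qed.

Lemma expect_absent f S : S \subset D -> independent f S ->
  expect (fun E => f E * [disjoint S & E]%:R) = q ^+ #|S| * expect f.
Proof.
move: {2}#|S| (erefl #|S|) => k; elim: k S => [|k IHk] S cS sS indf.
  rewrite cS expr0 mul1r; apply: eq_expect => E.
  by move/eqP: cS; rewrite cards_eq0 => /eqP ->; rewrite -setI_eq0 set0I eqxx mulr1.
have [e eS] : exists e, e \in S by apply/set0Pn; rewrite -cards_eq0 cS.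
have cS' : #|S :\ e| = k by have := cardsD1 e S; rewrite eS cS => -[].
have sS' : S :\ e \subset S by apply: subD1set.
have indf' : independent f (S :\ e) by move=> x E /(subsetP sS'); apply: indf.
rewrite cS exprS -mulrA -{1}cS' -IHk ?(subset_trans sS') //.
rewrite -(@expect_absent1 _ e) ?(subsetP sS) //.
  apply: eq_expect => E; rewrite -mulrA -natrM mulnb -{1}(setD1K eS).
  by rewrite disjoints_setU disjoints1 andbC.
move=> x E; rewrite inE => /eqP ->; rewrite indf //; congr (_ * (nat_of_bool _)%:R).
by apply: (@independent_absent [set e]); rewrite ?set11 // disjoints1 setD11.
Qed.

Lemma expect_present f S : S \subset D -> independent f S ->
  expect (fun E => f E * (S \subset E)%:R) = p ^+ #|S| * expect f.
Proof.
move: {2}#|S| (erefl #|S|) => k; elim: k S => [|k IHk] S cS sS indf.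
  rewrite cS expr0 mul1r; apply: eq_expect => E.
  by move/eqP: cS; rewrite cards_eq0 => /eqP ->; rewrite sub0set mulr1.
have [e eS] : exists e, e \in S by apply/set0Pn; rewrite -cards_eq0 cS.
have cS' : #|S :\ e| = k by have := cardsD1 e S; rewrite eS cS => -[].
have sS' : S :\ e \subset S by apply: subD1set.
have indf' : independent f (S :\ e) by move=> x E /(subsetP sS'); apply: indf.
rewrite cS exprS -mulrA -{1}cS' -IHk ?(subset_trans sS') //.
set g := (fun E => _ in X in _ = _ * X).
(* Presence of [e] is the complement of its absence, which reduces the claim to [expect_absent1]. *)
have -> : p * expect g = expect g - q * expect g by ring.
rewrite -(@expect_absent1 g e) ?(subsetP sS) //.
  rewrite -expectB; apply: eq_expect => E; rewrite /g -{1}(setD1K eS) subUset sub1set.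
  by case: (e \in E); rewrite /= ?mulr1 ?mulr0 ?subr0 ?subrr.
move=> x E; rewrite inE => /eqP ->; rewrite /g indf //; congr (_ * (nat_of_bool _)%:R).
by apply: (@independent_present [set e]); rewrite ?set11 // disjoints1 setD11.
Qed.

(* [f] and [S] depend only on [E :&: B], so fixing the value of [S E] reduces to
   [expect_absent]. *)
Lemma expect_absent_random f (S : {set T} -> {set T}) (B : {set T}) s :
  independent f (~: B) -> independent S (~: B) ->
  (forall E, S E \subset D :\: B) -> (forall E, #|S E| = s) ->
  expect (fun E => f E * [disjoint S E & E]%:R) = q ^+ s * expect f.
Proof.
move=> indf indS sS cS.
have split (g : {set T} -> {set T} -> R) :
    expect (fun E => g E (S E)) = \sum_(S0 : {set T}) expect (fun E => g E S0 * (S E == S0)%:R).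
  rewrite -expect_sum; apply: eq_expect => E.
  rewrite (bigD1 (S E)) //= eqxx mulr1 big1 ?addr0 // => S0.
  by rewrite eq_sym => /negbTE ->; rewrite mulr0.
rewrite (split (fun E S0 => f E * [disjoint S0 & E]%:R)) (split (fun E _ => f E)) big_distrr.
apply: eq_bigr => S0 _ /=.
have [/andP[sS0 /eqP <-]|nS0] := boolP ((S0 \subset D :\: B) && (#|S0| == s)); last first.
  have zero E : (S E == S0) = false.
    by apply/negbTE; apply: contra nS0 => /eqP <-; rewrite sS cS eqxx.
  rewrite /expect !big1 ?mulr0 // => E _; by rewrite zero mulr0 mul0r.
rewrite -(@expect_absent (fun E => f E * (S E == S0)%:R)).
- by apply: eq_expect => E; rewrite mulrAC.
- by apply: subset_trans sS0 (subsetDl _ _).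
- move=> e E /(subsetP sS0); rewrite inE => /andP[eB _].
  by rewrite indf ?indS ?inE.
Qed.

(** Peel off one set at a time: by disjointness, the event for the remaining sets does not depend on
    the elements of [S]. *)
Lemma expect_none_present (Ss : seq {set T}) c :
  all (fun S => (S \subset D) && (#|S| == c)) Ss ->
  pairwise (fun S S' => [disjoint S & S']) Ss ->
  expect (fun E => (all (fun S => ~~ (S \subset E)) Ss)%:R) = (1 - p ^+ c) ^+ size Ss.
Proof.
elim: Ss => [|S Ss IH] /=; first by rewrite expr0 expect1.
move=> /andP[/andP[sS /eqP cS] aS] /andP[dS pS].
rewrite exprS -IH // mulrBl mul1r -cS -expect_present // => [|e E eS]; last first.
  congr (nat_of_bool _)%:R; apply: eq_in_all => S' /(allP dS) dSS' /=; congr (~~ _).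
  exact: independent_present dSS' e E eS.
rewrite -expectB; apply: eq_expect => E.
by case: (S \subset E); case: all => /=; rewrite ?mulr1 ?mulr0 ?subrr ?subr0.
Qed.

End RandomSubset.

(** * Core triangles in the random graph *)

Section RandomCore.
Variables (n m : nat) (x : 'I_m * 'I_m * 'I_3 -> 'I_n).
Hypothesis x_inj : injective x.
Implicit Types (E : {set 'I_n * 'I_n}) (v w : 'I_n) (b j : 'I_m).

Definition reserved : {set 'I_n} := [set x y | y in [set: 'I_m * 'I_m * 'I_3]].
Local Notation V0 := reserved.

(** The pairs inspected when selecting triangles; all other pairs remain independent of the
    selection. *)
Definition reserved_pairs : {set 'I_n * 'I_n} := [set e | (e.1 \in V0) && (e.2 \in V0)].

(* [x (b, j, _)] are the vertices of the [j]-th triple of block [b]. *)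
Definition candidate b j : {set 'I_n * 'I_n} :=
  [set edge (x (b, j, c.1)) (x (b, j, c.2)) | c in pairs 3].

(* The default [b] is a junk value, taken only if block [b] spans no candidate triangle. *)
Definition selected E b : 'I_m := odflt b [pick j | candidate b j \subset E].

Definition core_vertex E (i : 'I_m * 'I_3) : 'I_n := x (i.1, selected E i.1, i.2).

Definition all_blocks_good E : bool := [forall b, exists j, candidate b j \subset E].

(** The potential edges from [v] to the first [k] selected triangles; [star k v E] is disjoint from
    [E] when [v] sees none of them. *)
Definition star k v E : {set 'I_n * 'I_n} :=
  [set edge v (core_vertex E i) | i in [set i : 'I_m * 'I_3 | (i.1 < k)%N]].

Lemma x_reserved y : x y \in V0.
Proof. by apply: imset_f; rewrite inE. Qed.

Lemma core_reserved E i : core_vertex E i \in V0.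
Proof. exact: x_reserved. Qed.

Lemma core_inj E : injective (core_vertex E).
Proof. by move=> [b a] [b' a'] /x_inj[/= -> _ ->]. Qed.

Lemma card_reserved : #|V0| = (m * m * 3)%N.
Proof. by rewrite card_imset // cardsT !card_prod !card_ord. Qed.

Lemma candidate_reserved b j : candidate b j \subset reserved_pairs.
Proof.
apply/subsetP => _ /imsetP[c _ ->]; rewrite inE /edge.
by case: ifP => _; rewrite /= !x_reserved.
Qed.

Lemma candidate_pairs b j : candidate b j \subset pairs n.
Proof.
apply/subsetP => _ /imsetP[c c12 ->]; apply: edge_pairs; move: c12; rewrite inE => c12.
rewrite (inj_eq x_inj) xpair_eqE eqxx /=.
by apply: contraTneq c12 => ->; rewrite ltnn.
Qed.

Lemma card_candidate b j : #|candidate b j| = 3.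
Proof.
rewrite card_in_imset => [|c c']; last first.
  rewrite !inE => lt lt' /edge_eq[[]|[]].
  - by case: c c' {lt lt'} => [c1 c2] [c1' c2'] /= /x_inj[->] /x_inj[->].
  move=> /x_inj[c12] /x_inj[c21].
  by move: lt lt'; rewrite c12 c21 => /ltnW; rewrite leqNgt => /negbTE ->.
rewrite -sum1dep_card big_mkcond /=.
rewrite -(pair_bigA _ (fun a a' : 'I_3 => if (a < a')%N then 1%N else 0%N)) /=.
by rewrite !big_ord_recl !big_ord0.
Qed.

Lemma candidate_disjoint b j j' : j != j' -> [disjoint candidate b j & candidate b j'].
Proof.
move=> jj'; rewrite -setI_eq0; apply: contraNT jj' => /set0Pn[e].
rewrite inE => /andP[/imsetP[c _ ->] /imsetP[c' _ /edge_eq[[]|[]]]].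
  by move=> /x_inj[->].
by move=> /x_inj[->].
Qed.

Lemma candidate_independent b j :
  independent (fun E => candidate b j \subset E) (~: reserved_pairs).
Proof.
by apply: independent_present; rewrite disjoint_sym disjoints_subset setCK candidate_reserved.
Qed.

Lemma selected_independent b : independent (selected^~ b) (~: reserved_pairs).
Proof.
move=> e E he; rewrite /selected; congr odflt; apply: eq_pick => j.
exact: candidate_independent.
Qed.

Lemma core_independent i : independent (core_vertex^~ i) (~: reserved_pairs).
Proof. by move=> e E he; rewrite /core_vertex selected_independent. Qed.

Lemma star_independent k v : independent (star k v) (~: reserved_pairs).
Proof. by move=> e E he; apply: eq_imset => i; rewrite core_independent. Qed.

Lemma good_independent : independent all_blocks_good (~: reserved_pairs).
Proof.
move=> e E he; apply: eq_forallb => b; apply: eq_existsb => j.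
exact: candidate_independent.
Qed.

Lemma star_sub k v E : v \notin V0 -> star k v E \subset pairs n :\: reserved_pairs.
Proof.
move=> vV; apply/subsetP => _ /imsetP[i _ ->]; rewrite in_setD edge_pairs ?andbT; last first.
  by apply: contraNneq vV => ->; apply: core_reserved.
by rewrite inE /edge negb_and; case: ifP => _ /=; rewrite vV ?orbT.
Qed.

Lemma card_star k v E : v \notin V0 -> (k <= m)%N -> #|star k v E| = (k * 3)%N.
Proof.
move=> vV km; rewrite card_imset ?card_ltn_fst // => i i' /edge_eq[[_ /core_inj]|[vE _]] //.
by rewrite vE core_reserved in vV.
Qed.

Lemma star_disjoint k l v w E : v \notin V0 -> v != w -> [disjoint star k v E & star l w E].
Proof.
move=> vV; rewrite -setI_eq0; apply: contraNT => /set0Pn[e].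
rewrite inE => /andP[/imsetP[i _ ->] /imsetP[i' _ /edge_eq[[-> //]|[vE _]]]].
by rewrite vE core_reserved in vV.
Qed.

Lemma star_adj k v E : E \subset pairs n ->
  [disjoint star k v E & E] = [forall i : 'I_m * 'I_3, (i.1 < k)%N ==> ~~ adj E v (core_vertex E i)].
Proof.
move=> sE; apply/idP/forallP => [dS i|nadj].
  apply/implyP => ik; rewrite adjE //; rewrite (disjointFr dS) //.
  by apply: imset_f; rewrite inE.
rewrite -setI_eq0; apply/negPn/negP => /set0Pn[e]; rewrite inE => /andP[/imsetP[i ik ->]].
by rewrite -adjE //; apply/negP; move: ik (nadj i); rewrite inE => -> .
Qed.

Lemma core_adj b a a' E : all_blocks_good E -> E \subset pairs n -> a != a' ->
  adj E (core_vertex E (b, a)) (core_vertex E (b, a')).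
Proof.
move=> /forallP/(_ b)/existsP[j0 hj0] sE.
(* In a good graph every block has a candidate, so the default value of [selected] does not
   occur. *)
have /subsetP sel : candidate b (selected E b) \subset E.
  by rewrite /selected; case: pickP => [j //|/(_ j0)]; rewrite hj0.
wlog lt : a a' / (a < a')%N => [hw aa'|_].
  have [/hw->//|] := ltnP a a'; rewrite leq_eqVlt eq_sym (inj_eq val_inj) (negbTE aa') /=.
  by move=> /hw; rewrite adj_sym eq_sym; apply.
by rewrite adjE //; apply: sel; apply/imsetP; exists (a, a'); rewrite ?inE.
Qed.

(* Under the hypotheses of [satC4_misses] this is the index of the first triangle seen by [v]. *)
Definition misses v E : nat := \sum_(k < m) [disjoint star k.+1 v E & E].

Lemma satC4_misses E : (0 < m)%N -> E \subset pairs n -> all_blocks_good E ->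
  (forall v, v \notin V0 -> ~~ [disjoint star m v E & E]) ->
  (2 * satC4 E <= 9 * m ^ 4 + 18 * m ^ 3 + 3 * n + 6 * \sum_(v | v \notin V0) misses v E)%N.
Proof.
move=> m0 sE gE hit.
pose i0 : 'I_m * 'I_3 := (Ordinal m0, ord0).
pose first v i := adj E v (core_vertex E i) &&
  [forall i' : 'I_m * 'I_3, (i'.1 < i.1)%N ==> ~~ adj E v (core_vertex E i')].
pose par v := odflt i0 [pick i | first v i].
(* Outside [V0] the default [i0] is never taken: [hit] provides a core neighbour, and one of minimal
   level qualifies as first. *)
have parP v : v \notin V0 -> first v (par v).
  move=> /hit; rewrite star_adj // negb_forall => /existsP[i1].
  rewrite negb_imply negbK => /andP[_ adj1]; rewrite /par.
  case: pickP => [//|none].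
  have [i adji min] := @arg_minnP _ i1 (fun i => adj E v (core_vertex E i))
    (fun i => nat_of_ord i.1) adj1.
  have /negP[] := none i; rewrite /first adji; apply/forallP => i'; apply/implyP => lt.
  by apply/negP => /min; rewrite leqNgt lt.
have := @satC4_core_bound n m E V0 (core_vertex E) par sE (@core_inj E)
  (@core_reserved E) (fun b a a' => core_adj b gE sE) (fun v vV => proj1 (andP (parP v vV))).
rewrite card_reserved => /leq_trans; apply.
have le : (\sum_(v | v \notin V0) (par v).1 <= \sum_(v | v \notin V0) misses v E)%N.
  apply: leq_sum => v vV; rewrite /misses.
  have /andP[_ /forallP far] := parP v vV.
  (* The level is the number of [k] below it, and for each such [k] the first [k.+1] triangles are
     all missed by [v]. *)
  have -> : nat_of_ord (par v).1 = (\sum_(k < m) (k < (par v).1))%N.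
    rewrite -(big_mkord predT (fun k => k < (par v).1 : nat)).
    rewrite (big_cat_nat (n := (par v).1)) //=; last by apply: ltnW.
    rewrite big_nat_cond (eq_bigr (fun=> 1%N)) => [|k]; last by rewrite andbT => /andP[_ ->].
    rewrite -big_nat_cond sum_nat_const_nat subn0 muln1 big_nat_cond big1 ?addn0 // => k.
    by rewrite andbT leqNgt => /andP[/negbTE ->].
  apply: leq_sum => k _; case: ltnP => // lt; rewrite lt0b star_adj //.
  apply/forallP => i; apply/implyP => ik; apply: (implyP (far i)); lia.
have -> : ((m * m * 3) ^ 2 = 9 * m ^ 4)%N by ring.
have -> : (6 * m * (m * m * 3) = 18 * m ^ 3)%N by ring.
by rewrite !leq_add2l leq_mul2l le.
Qed.

End RandomCore.

(** * First and second moments of the levels *)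

Section Moments.
Variables (R : realType) (p : R) (n m : nat) (x : 'I_m * 'I_m * 'I_3 -> 'I_n).
Hypotheses (p0 : 0 <= p) (p1 : p <= 1) (x_inj : injective x).
Local Notation q := (1 - p).
Local Notation V0 := (reserved x).
Local Notation Ex := (expect (pairs n) p).
Local Notation good := (all_blocks_good x).
Local Notation star := (star x).
Implicit Types (E : {set 'I_n * 'I_n}) (v w : 'I_n).

Lemma expect_star k v : v \notin V0 -> (k <= m)%N ->
  Ex (fun E => (good E)%:R * [disjoint star k v E & E]%:R) =
  q ^+ (k * 3) * Ex (fun E => (good E)%:R).
Proof.
move=> vV km; apply: (@expect_absent_random _ _ (pairs n) p _ _ (reserved_pairs x)).
- by move=> e E he; rewrite good_independent.
- exact: star_independent.
- by move=> E; apply: star_sub.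
- by move=> E; apply: card_star.
Qed.

(** The two stars are disjoint, so their union is a set of [k * 3 + l * 3] unreserved pairs chosen
    from reserved information only. *)
Lemma expect_star2 k l v w : v \notin V0 -> w \notin V0 -> v != w -> (k <= m)%N -> (l <= m)%N ->
  Ex (fun E => (good E)%:R * ([disjoint star k v E & E]%:R * [disjoint star l w E & E]%:R)) =
  q ^+ (k * 3 + l * 3) * Ex (fun E => (good E)%:R).
Proof.
move=> vV wV vw km lm.
rewrite -(@expect_absent_random _ _ (pairs n) p _ (fun E => star k v E :|: star l w E)
  (reserved_pairs x)).
- by apply: eq_expect => E; rewrite disjoints_setU -mulnb natrM.
- by move=> e E he; rewrite good_independent.
- by move=> e E he; rewrite !star_independent.
- by move=> E; rewrite subUset !star_sub.
- move=> E; rewrite cardsU !card_star // (_ : _ :&: _ = set0) ?cards0 ?subn0 //.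
  by apply/eqP; rewrite setI_eq0 star_disjoint.
Qed.

(** The mean as a sum of tail probabilities: the first [k.+1] triangles are all missed with
    probability [q ^+ (k.+1 * 3)]. *)
Definition mean_misses : R := \sum_(k < m) q ^+ (k.+1 * 3).
Local Notation nu := mean_misses.

Let mE v E : (misses x v E)%:R = \sum_(k < m) [disjoint star k.+1 v E & E]%:R :> R.
Proof. by rewrite natr_sum. Qed.

Lemma expect_misses v : v \notin V0 ->
  Ex (fun E => (good E)%:R * (misses x v E)%:R) = nu * Ex (fun E => (good E)%:R).
Proof.
move=> vV; rewrite /nu big_distrl /=.
under eq_bigr => k _ do rewrite -(expect_star vV (ltn_ord k)).
by rewrite -expect_sum; apply: eq_expect => E; rewrite mE big_distrr.
Qed.

Lemma expect_misses2 v w : v \notin V0 -> w \notin V0 -> v != w ->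
  Ex (fun E => (good E)%:R * ((misses x v E)%:R * (misses x w E)%:R)) =
  nu ^+ 2 * Ex (fun E => (good E)%:R).
Proof.
move=> vV wV vw; rewrite expr2 /nu big_distrlr /= big_distrl /=.
under eq_bigr => k _ do rewrite big_distrl /=.
under eq_bigr => k _ do under eq_bigr => l _ do
  rewrite -exprD -(expect_star2 vV wV vw (ltn_ord k) (ltn_ord l)).
under eq_bigr => k _ do rewrite -expect_sum.
rewrite -expect_sum; apply: eq_expect => E; rewrite !mE big_distrlr /= big_distrr /=.
by apply: eq_bigr => k _; rewrite big_distrr.
Qed.

Lemma mean_misses_ge0 : 0 <= nu.
Proof. by apply: sumr_ge0 => k _; rewrite exprn_ge0 // subr_ge0. Qed.

Lemma mean_misses_le : nu <= m%:R.
Proof.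
rewrite -[leRHS]mulr1 mulr_natl -[m in leRHS]card_ord -sumr_const; apply: ler_sum => k _.
by rewrite exprn_ile1 ?subr_ge0 // gerBl.
Qed.

Lemma misses_le v E : (misses x v E <= m)%N.
Proof.
rewrite -[leqRHS]card_ord -sum1_card; apply: leq_sum => k _; exact: leq_b1.
Qed.

Let dev E : R := \sum_(v | v \notin V0) ((misses x v E)%:R - nu).

(** The covariances for distinct vertices vanish. Each of the at most [n] diagonal terms is at most
    [m%:R ^+ 2], because both [misses] and its mean lie between 0 and [m]. *)
Lemma variance_misses : Ex (fun E => (good E)%:R * dev E ^+ 2) <= n%:R * m%:R ^+ 2.
Proof.
pose c v w E : R := (good E)%:R * (((misses x v E)%:R - nu) * ((misses x w E)%:R - nu)).
have -> : Ex (fun E => (good E)%:R * dev E ^+ 2) =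
    \sum_(v | v \notin V0) \sum_(w | w \notin V0) Ex (c v w).
  under eq_bigr => v _ do rewrite -expect_sum.
  rewrite -expect_sum; apply: eq_expect => E; rewrite expr2 /dev big_distrlr big_distrr /=.
  by apply: eq_bigr => v _; rewrite big_distrr.
have off v w : v \notin V0 -> w \notin V0 -> v != w -> Ex (c v w) = 0.
  move=> vV wV vw.
  transitivity (Ex (fun E => (good E)%:R * ((misses x v E)%:R * (misses x w E)%:R)
    - nu * ((good E)%:R * (misses x v E)%:R) - nu * ((good E)%:R * (misses x w E)%:R)
    + nu ^+ 2 * (good E)%:R)).
    by apply: eq_expect => E; rewrite /c; ring.
  rewrite expectD !expectB !expectZ expect_misses2 // !expect_misses //; ring.
have diag v : Ex (c v v) <= m%:R ^+ 2.
  have <- : Ex (fun=> m%:R ^+ 2 * 1) = m%:R ^+ 2 by rewrite expectZ expect1 mulr1.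
  apply: le_expect => // E _.
  have lem : (misses x v E)%:R <= m%:R :> R by rewrite ler_nat misses_le.
  have ge0 : 0 <= (misses x v E)%:R :> R by [].
  have := mean_misses_ge0; have := mean_misses_le.
  rewrite mulr1 /c => h1 h2.
  apply: (@le_trans _ _ (((misses x v E)%:R - nu) * ((misses x v E)%:R - nu))).
    by case: (good E); rewrite ?mul1r ?mul0r // -expr2 sqr_ge0.
  rewrite -subr_ge0 -expr2 subr_sqr mulr_ge0 //; lra.
apply: (@le_trans _ _ (\sum_(v : 'I_n) m%:R ^+ 2)); last first.
  by rewrite sumr_const card_ord mulr_natl.
rewrite big_mkcond; apply: ler_sum => v _; case: ifP => vV; last by rewrite exprn_ge0.
rewrite (bigD1 v) //= big1 ?addr0 // => w /andP[wV wv]; by apply: off => //; rewrite eq_sym.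
Qed.

(** Union bound over the blocks: the [m] candidates of a block are disjoint triples of pairs, each
    present with probability [p ^+ 3]. *)
Lemma prob_good : 1 - m%:R * (1 - p ^+ 3) ^+ m <= Ex (fun E => (good E)%:R).
Proof.
pose bad b E := all (fun S : {set 'I_n * 'I_n} => ~~ (S \subset E)) (map (candidate x b) (enum 'I_m)).
have badE b : Ex (fun E => (bad b E)%:R) = (1 - p ^+ 3) ^+ m.
  have sz : size (map (candidate x b) (enum 'I_m)) = m by rewrite size_map size_enum_ord.
  rewrite (@expect_none_present _ _ _ _ _ 3%N) ?sz //.
    by apply/allP => S /mapP[j _ ->]; rewrite candidate_pairs ?card_candidate.
  rewrite pairwise_map; have : uniq (enum 'I_m) by apply: enum_uniq.
  rewrite uniq_pairwise; apply: sub_pairwise => j j' /=; exact: candidate_disjoint.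
have -> : m%:R * (1 - p ^+ 3) ^+ m = \sum_(b : 'I_m) Ex (fun E => (bad b E)%:R).
  by rewrite (eq_bigr (fun=> (1 - p ^+ 3) ^+ m)) // sumr_const card_ord mulr_natl.
rewrite -expect_sum -{1}(expect1 (pairs n) p) -expectB; apply: le_expect => // E _.
have [gE|] := boolP (good E).
  by rewrite gerBl sumr_ge0.
rewrite negb_forall => /existsP[b]; rewrite negb_exists => /forallP none.
have bE : bad b E by apply/allP => _ /mapP[j _ ->].
by rewrite (bigD1 b) //= bE opprD addrA subrr add0r oppr_le0 sumr_ge0.
Qed.

Lemma prob_satC4 (lam bound : R) : (0 < m)%N -> 0 < lam ->
  9 * m%:R ^+ 4 + 18 * m%:R ^+ 3 + 3 * n%:R + 6 * (n%:R * nu + lam) <= 2 * bound ->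
  1 - m%:R * (1 - p ^+ 3) ^+ m - n%:R * q ^+ (m * 3) - n%:R * m%:R ^+ 2 / lam ^+ 2
  <= PrGnp p (fun E : {set 'I_n * 'I_n} => (satC4 E)%:R <= bound).
Proof.
move=> m0 lam0 hb.
have -> : PrGnp p (fun E : {set 'I_n * 'I_n} => (satC4 E)%:R <= bound) =
    Ex (fun E => (((satC4 E)%:R <= bound)%R)%:R).
  rewrite /PrGnp /expect big_mkcondr; apply: eq_bigr => E _; rewrite /weight.
  by case: ifP => _; rewrite ?mul1r ?mul0r.
pose hit E := \sum_(v | v \notin V0) (good E)%:R * [disjoint star m v E & E]%:R : R.
have hitE : Ex hit <= n%:R * q ^+ (m * 3).
  rewrite expect_sum; apply: (@le_trans _ _ (\sum_(v : 'I_n) q ^+ (m * 3))); last first.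
    by rewrite sumr_const card_ord mulr_natl.
  have q0 : 0 <= q ^+ (m * 3) by rewrite exprn_ge0 // subr_ge0.
  rewrite big_mkcond; apply: ler_sum => v _; case: ifP => vV //.
  rewrite expect_star // ler_piMr // -[leRHS](expect1 (pairs n) p); apply: le_expect => // E _.
  by case: (good E).
(* A pointwise lower bound for the indicator of success. Each failure (a bad block, a vertex seeing
   no triangle, a deviation above [lam]) makes the right side at most 0; expectation then gives the
   union, Markov and Chebyshev bounds together. *)
apply: (@le_trans _ _ (Ex (fun E => (good E)%:R - hit E
    - lam ^- 2 * ((good E)%:R * dev E ^+ 2)))).
  rewrite !expectB expectZ.
  have l2 : 0 <= lam ^- 2 by rewrite invr_ge0 exprn_ge0 // ltW.
  have := ler_wpM2l l2 variance_misses; rewrite [_ * (n%:R * _)]mulrC.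
  have := prob_good; move: hitE; lra.
apply: le_expect => // E sE; have [gE|] := boolP (good E); last first.
  move=> ng; rewrite /hit big1 ?mul0r ?mulr0 ?subr0 // => v _; by rewrite (negbTE ng) mul0r.
rewrite (_ : true%:R = 1 :> R) // mul1r; have dge0 : 0 <= lam ^- 2 * dev E ^+ 2.
  by rewrite mulr_ge0 ?sqr_ge0 // invr_ge0 sqr_ge0.
have hge0 : 0 <= hit E by apply: sumr_ge0 => v _; rewrite mulr_ge0.
have [/existsP[v /andP[vV dv]]|] :=
    boolP [exists v, (v \notin V0) && [disjoint star m v E & E]].
  have h1 : 1 <= hit E.
    by rewrite /hit (bigD1 v) //= gE dv mul1r lerDl sumr_ge0 // => w _; rewrite mulr_ge0.
  apply: (@le_trans _ _ 0) => //; move: dge0 h1; lra.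
rewrite negb_exists => /forallP nohit.
have [le|lt] := lerP (dev E) lam; last first.
  have h1 : 1 <= lam ^- 2 * dev E ^+ 2.
    rewrite -(mulVf (x := lam ^+ 2)) ?expf_neq0 ?gt_eqF // ler_wpM2l ?invr_ge0 ?sqr_ge0 //.
    by rewrite lerXn2r ?nnegrE ?ltW // (lt_trans lam0).
  apply: (@le_trans _ _ 0) => //; move: hge0 h1; lra.
suff -> : (satC4 E)%:R <= bound by rewrite (_ : true%:R = 1 :> R) //; move: hge0 dge0; lra.
have := @satC4_misses n m x x_inj E m0 sE gE.
have hitv v : v \notin V0 -> ~~ [disjoint star m v E & E].
  by move=> vV; have := nohit v; rewrite vV.
move=> /(_ hitv); rewrite -(ler_nat R) 3!natrD (natrM _ 2) (natrM _ 9) (natrM _ 18) (natrM _ 3).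
rewrite (natrM _ 6) 2!natrX natr_sum => hs.
have sumE : \sum_(v | v \notin V0) (misses x v E)%:R = dev E + \sum_(v | v \notin V0) nu.
  by rewrite /dev sumrB subrK.
have nun : \sum_(v | v \notin V0) nu <= n%:R * nu.
  rewrite mulr_natl -[n in leRHS]card_ord -sumr_const big_mkcond; apply: ler_sum => v _.
  by case: ifP => // _; apply: mean_misses_ge0.
move: hs hb le nun; rewrite sumE; lra.
Qed.

End Moments.

(** * Asymptotics *)

From mathcomp Require Import all_classical all_reals all_analysis.
Import numFieldNormedType.Exports.
Local Open Scope classical_set_scope.
Local Open Scope ring_scope.

Lemma bernoulli_ineq (R : realFieldType) (t : R) k : t <= 1 -> 1 - k%:R * t <= (1 - t) ^+ k.
Proof.
move=> t1; elim: k => [|k IHk]; first by rewrite mul0r subr0 expr0.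
have t0 : 0 <= 1 - t by lra.
have := ler_wpM2l t0 IHk; rewrite -exprS; apply: le_trans.
have : 0 <= k%:R * t ^+ 2 by rewrite mulr_ge0 ?sqr_ge0.
rewrite -natr1; lra.
Qed.

Lemma sum_geometric (R : realFieldType) (z : R) k :
  (1 - z) * \sum_(i < k) z ^+ i = 1 - z ^+ k.
Proof.
elim: k => [|k IHk]; first by rewrite big_ord0 mulr0 expr0 subrr.
by rewrite big_ord_recr /= mulrDr IHk exprS; ring.
Qed.

(** Bernoulli gives [y <= z ^+ 6], so it suffices to bound [k.+1%:R * z ^+ k], which is at most the
    geometric sum of the larger powers of [z], hence at most [(1 - z)^-1]. The exponent 6 allows for
    [n], below [m.+1 ^ 5], and one more factor [m.+1] of decay. *)
Lemma poly_geometric_bounded (R : realFieldType) (y : R) : 0 <= y -> y < 1 ->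
  exists C, forall k, k.+1%:R ^+ 6 * y ^+ k <= C.
Proof.
move=> y0 y1; pose z := 1 - (1 - y) / 6.
have [z0 z1] : 0 <= z /\ z < 1 by rewrite /z; split; lra.
have w0 : 0 < 1 - z by lra.
have yz : y <= z ^+ 6 by apply: le_trans (bernoulli_ineq 6 _); lra.
exists ((1 - z)^-1 ^+ 6) => k.
apply: (@le_trans _ _ ((k.+1%:R * z ^+ k) ^+ 6)).
  by rewrite exprMn ler_wpM2l ?exprn_ge0 // -exprM mulnC exprM lerXn2r ?nnegrE ?exprn_ge0.
apply: lerXn2r; rewrite ?nnegrE ?mulr_ge0 ?exprn_ge0 ?invr_ge0 ?(ltW w0) //.
rewrite -[leRHS]mulr1 ler_pdivlMl //.
apply: (@le_trans _ _ ((1 - z) * \sum_(i < k.+1) z ^+ i)); last first.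
  by rewrite sum_geometric gerBl exprn_ge0.
rewrite ler_wpM2l ?(ltW w0) // mulr_natl -[k.+1 in leLHS]card_ord -sumr_const.
by apply: ler_sum => i _; rewrite ler_wiXn2l ?(ltW z1) // -ltnS.
Qed.

Lemma mean_misses_geometric (R : realType) (p : R) m : 0 < p -> p < 1 ->
  mean_misses p m <= (1 - p) ^+ 3 / (1 - (1 - p) ^+ 3).
Proof.
move=> p0 p1; have q3 : (1 - p) ^+ 3 < 1 by rewrite exprn_ilt1 //; lra.
have q30 : 0 <= (1 - p) ^+ 3 by rewrite exprn_ge0 //; lra.
rewrite ler_pdivlMr ?subr_gt0 // mulrC /mean_misses.
under eq_bigr => k _ do rewrite mulnC exprM exprS.
rewrite -big_distrr /= mulrCA sum_geometric ler_piMr // gerBl exprn_ge0 //.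
Qed.

Lemma root5_ex n : exists m, (n < m.+1 ^ 5)%N.
Proof. by exists n; apply: (leq_trans (ltnSn n)); rewrite -[X in (X <= _)%N]expn1 leq_pexp2l. Qed.

(** The integer fifth root, used as the number of blocks: it makes the term [9 * m ^ 4] of order at
    most [n / m]. *)
Definition root5 n := ex_minn (root5_ex n).

Lemma root5_lt n : (n < (root5 n).+1 ^ 5)%N.
Proof. by rewrite /root5; case: ex_minnP. Qed.

Lemma root5_le n : (root5 n ^ 5 <= n)%N.
Proof.
rewrite /root5; case: ex_minnP => -[|k] _ min; first by rewrite exp0n.
by rewrite leqNgt; apply/negP => /min; rewrite ltnn.
Qed.

Lemma cvg_root5 : root5 @ \oo --> \oo.
Proof.
apply/cvgnyPge => A; exists (A ^ 5)%N => // n /= An.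
have := leq_ltn_trans An (root5_lt n); rewrite ltn_exp2r //.
Qed.

Lemma injection_ord (T : finType) n : (#|T| <= n)%N -> exists f : T -> 'I_n, injective f.
Proof.
move=> le; exists (fun y => widen_ord le (enum_rank y)) => y y' /(congr1 val) /= /val_inj.
exact: enum_rank_inj.
Qed.

Lemma PrGnp_le1 (R : realType) (p : R) n A : 0 <= p -> p <= 1 -> @PrGnp R p n A <= 1.
Proof.
move=> p0 p1; rewrite -[leRHS](expect1 (pairs n) p) /PrGnp big_mkcondr.
apply: ler_sum => E _; rewrite mul1r; case: ifP => // _; exact: weight_ge0.
Qed.

Lemma prob_satC4_lower (R : realType) (p mu c : R) : 0 < p -> p < 1 ->
  (forall m, mean_misses p m <= mu) -> 3 / 2 + 3 * mu <= c ->
  exists C, forall n, (2 <= root5 n)%N ->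
  1 - C * harmonic (root5 n) <= PrGnp p (fun G : {set 'I_n * 'I_n} =>
    (satC4 G)%:R <= c * n%:R * (1 + 34 * harmonic (root5 n))).
Proof.
move=> p0 p1 hmu hc; have [q0 q1] : 0 <= 1 - p /\ 1 - p < 1 by split; lra.
have [C1 hC1] : exists C, forall k, k.+1%:R ^+ 6 * ((1 - p) ^+ 3) ^+ k <= C.
  by apply: poly_geometric_bounded; rewrite ?exprn_ge0 ?exprn_ilt1.
have [C2 hC2] : exists C, forall k, k.+1%:R ^+ 6 * (1 - p ^+ 3) ^+ k <= C.
  apply: poly_geometric_bounded; first by rewrite subr_ge0 exprn_ile1 // ltW.
  by rewrite gtrBl exprn_gt0.
(* [C2] pays for blocks without a triangle, [C1] for vertices seeing no triangle, and 2 for the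
   Chebyshev term. *)
exists (C2 + C1 + 2) => n; set m := root5 n => m2.
have mn : m%:R ^+ 5 <= n%:R :> R by rewrite -natrX ler_nat root5_le.
have nm : n%:R <= m.+1%:R ^+ 5 :> R by rewrite -natrX ler_nat ltnW ?root5_lt.
(* There is room for the [3 * m ^ 2] reserved vertices, as [3 <= 2 ^ 3 <= m ^ 3] and
   [m ^ 5 <= n]. *)
have [x x_inj] : exists x : 'I_m * 'I_m * 'I_3 -> 'I_n, injective x.
  apply: injection_ord; rewrite !card_prod !card_ord; apply: leq_trans (root5_le n).
  rewrite -/m (expnD m 2 3) mulnn leq_mul //.
  by apply: (@leq_trans (2 ^ 3)) => //; rewrite leq_exp2r.
have M2 : 2 <= m%:R :> R by rewrite ler_nat.
have n0 : 0 < n%:R :> R by apply: lt_le_trans mn; rewrite exprn_gt0 //; lra.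
have M0 : 0 < m%:R :> R by lra.
set h := harmonic m; have hE : m.+1%:R * h = 1 by rewrite /h /= mulfV ?pnatr_eq0.
have h0 : 0 < h by rewrite /h /= invr_gt0.
have hm : m%:R^-1 <= 2 * h.
  rewrite /h /= ler_pdivlMr // -natr1 mulrDr mulr1 mulVf ?gt_eqF //.
  have : m%:R^-1 <= 1 :> R by rewrite invf_le1 //; lra.
  lra.
have nu0 : 0 <= mean_misses p m by apply: mean_misses_ge0; lra.
have mu0 : 0 <= mu := le_trans nu0 (hmu m).
have nm0 : 0 < n%:R / m%:R :> R by rewrite divr_gt0.
have poly : 9 * m%:R ^+ 4 + 18 * m%:R ^+ 3 <= 18 * (n%:R / m%:R) :> R.
  rewrite mulrA ler_pdivlMr //; apply: (@le_trans _ _ (18 * m%:R ^+ 5)); last by rewrite ler_wpM2l.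
  have : 0 <= m%:R ^+ 4 * (m%:R - 2) :> R by rewrite mulr_ge0 ?exprn_ge0 //; lra.
  rewrite !exprS expr0; lra.
have nh : n%:R / m%:R <= 2 * (n%:R * h).
  by rewrite mulrCA ler_wpM2l // ltW.
(* The deviation [n / m] is negligible against [n], yet its Chebyshev term is [m ^ 4 / n], at most
   [1 / m]. *)
have := @prob_satC4 R p n m x (ltW p0) (ltW p1) x_inj (n%:R / m%:R)
  (c * n%:R * (1 + 34 * h)) (ltnW m2) nm0.
(* The lower-order terms total at most [24 * n / m], hence [48 * n * h]; since [c] is at least 3/2,
   the factor 34 leaves room for [102 * n * h]. *)
have bnd : 9 * m%:R ^+ 4 + 18 * m%:R ^+ 3 + 3 * n%:R + 6 * (n%:R * mean_misses p m + n%:R / m%:R)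
    <= 2 * (c * n%:R * (1 + 34 * h)).
  have e1 : n%:R * mean_misses p m <= n%:R * mu by rewrite ler_wpM2l.
  have e2 : (3 / 2 + 3 * mu) * n%:R <= c * n%:R by rewrite ler_wpM2r.
  have nh0 : 0 <= n%:R * h by rewrite mulr_ge0 // ltW.
  have e3 : 3 / 2 * (n%:R * h) <= c * (n%:R * h) by rewrite ler_wpM2r //; lra.
  move: e1 e2 e3 nh poly nh0; lra.
move=> /(_ bnd); apply: le_trans.
have f1 : m%:R * (1 - p ^+ 3) ^+ m <= C2 * h.
  rewrite ler_pdivlMr //; apply: le_trans (hC2 m); rewrite mulrAC ler_wpM2r //.
    by rewrite exprn_ge0 // subr_ge0 exprn_ile1 // ltW.
  have : m%:R * m.+1%:R <= m.+1%:R ^+ 2 :> R by rewrite expr2 ler_wpM2r // ler_nat.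
  by move=> /le_trans; apply; rewrite ler_weXn2l // ler1n.
have f2 : n%:R * (1 - p) ^+ (m * 3) <= C1 * h.
  rewrite ler_pdivlMr //; apply: le_trans (hC1 m); rewrite mulrAC mulnC exprM.
  by rewrite ler_wpM2r ?exprn_ge0 // [leRHS]exprSr ler_wpM2r.
have f3 : n%:R * m%:R ^+ 2 / (n%:R / m%:R) ^+ 2 <= 2 * h.
  apply: le_trans hm.
  have -> : n%:R * m%:R ^+ 2 / (n%:R / m%:R) ^+ 2 = m%:R ^+ 4 / n%:R :> R.
    by field; rewrite !gt_eqF.
  by rewrite ler_pdivrMr // mulrC ler_pdivlMr // -exprSr.
move: f1 f2 f3; lra.
Qed.

Lemma satC4_whp (R : realType) (p mu c : R) : 0 < p -> p < 1 ->
  (forall m, mean_misses p m <= mu) -> 3 / 2 + 3 * mu <= c ->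
  exists e : nat -> R, e @ \oo --> (0 : R) /\
  (fun n => PrGnp p (fun G : {set 'I_n * 'I_n} => (satC4 G)%:R <= c * n%:R * (1 + e n)))
    @ \oo --> (1 : R).
Proof.
move=> p0 p1 hmu hc; have hcvg : (fun n => harmonic (root5 n)) @ \oo --> (0 : R).
  exact: cvg_comp cvg_root5 (@cvg_harmonic R).
have hcvgM (a : R) : (fun n => a * harmonic (root5 n)) @ \oo --> (0 : R).
  by rewrite -(mulr0 a); apply: cvgM => //; apply: cvg_cst.
exists (fun n => 34 * harmonic (root5 n)); split => //.
have [C hC] := prob_satC4_lower p0 p1 hmu hc.
apply: (@squeeze_cvgr _ _ _ _ (fun n => 1 - C * harmonic (root5 n)) (fun=> 1)).
- near=> n; rewrite hC; last by near: n; apply: (cvgnyPge root5).1 cvg_root5 2%N.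
  by rewrite PrGnp_le1 // ltW.
- by rewrite -[X in _ --> X]subr0; apply: cvgB => //; apply: cvg_cst.
- exact: cvg_cst.
Unshelve. all: by end_near.
Qed.

(** * Comparison of the two bounds *)

Lemma threshold_degree (R : realFieldType) (q : R) s : 0 <= q -> q <= 1 -> 7^-1 <= q ^+ 3 ->
  (2 * s%:R ^+ 2 + 1) * q ^+ s < 1 -> 2 <= s%:R * (1 - q).
Proof.
move=> q0 q1 q7 hs.
have qh : 2^-1 <= q.
  rewrite leNgt; apply/negP => lt.
  have : q ^+ 3 <= 2^-1 ^+ 3 by apply: lerXn2r; rewrite ?nnegrE // ?invr_ge0 // ltW.
  by rewrite !exprS expr0; move: q7; rewrite !exprS expr0; lra.
have [s8|] := leqP 8 s; last first.
  have qX k : 2^-1 ^+ k <= q ^+ k by apply: lerXn2r; rewrite ?nnegrE ?invr_ge0.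
  (* For [s] below 7 the bound [2^-1 ^+ s <= q ^+ s] already contradicts [hs]. The case [s = 7]
     needs [q ^+ 7] at least 1/98, against the factor 99. *)
  have q77 : 7^-1 * (7^-1 * 2^-1) <= q ^+ 7.
    rewrite (exprD q 3 4) (exprD q 3 1) expr1.
    by rewrite !ler_pM ?mulr_ge0 ?invr_ge0.
  move=> s7; exfalso; move: hs (qX s) s7 q77.
  by do 8![case: s => [|s]; first by rewrite ?exprS ?expr0; lra].
(* Bernoulli for exponent [s] could give a negative bound, so it is applied to [h], the ceiling of
   [s / 4]. If [s * (1 - q) < 2], then [h * (1 - q) < 11 / 16], so [q ^+ h] exceeds 5/16, and
   [129 * (5 / 16) ^+ 4 > 1] contradicts [hs]. *)
rewrite leNgt; apply/negP => lt; have := bernoulli_ineq ((s + 3) %/ 4) (_ : 1 - q <= 1).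
rewrite subKr => /(_ ltac:(lra)); set h := (_ %/ 4)%N => bern.
have sR : 8 <= s%:R :> R by rewrite ler_nat.
have h4 : 4 * h%:R <= s%:R + 3 :> R by rewrite -natrM -natrD ler_nat /h; lia.
have sh : (s <= h * 4)%N by rewrite /h; lia.
have t4 : 1 - q <= 4^-1.
  have := ler_wpM2r (_ : 0 <= 1 - q) sR; move=> /(_ ltac:(lra)); lra.
have ht : 4 * (h%:R * (1 - q)) <= s%:R * (1 - q) + 3 * (1 - q).
  by rewrite mulrA -mulrDl ler_wpM2r //; lra.
have qs : (5 / 16) ^+ 4 <= q ^+ s.
  apply: (@le_trans _ _ ((q ^+ h) ^+ 4)); last by rewrite -exprM ler_wiXn2l.
  by apply: lerXn2r; rewrite ?nnegrE ?exprn_ge0 //; lra.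
have s2 : 64 <= s%:R ^+ 2 :> R by rewrite -natrX ler_nat (@leq_exp2r 8 s 2).
have : 129 * (5 / 16) ^+ 4 <= (2 * s%:R ^+ 2 + 1) * q ^+ s.
  by apply: ler_pM => //; rewrite ?exprn_ge0 //; lra.
move: hs; rewrite [(5 / 16) ^+ 4]exprS !exprS expr0; lra.
Qed.

Unset Implicit Arguments.

Theorem theorem2 (R : realType) (p : R) (hp0 : 0 < p) (hp1 : p < 1) :
  (1 - 1 / powR 7 (3^-1) < p ->
   exists eps : nat -> R, eps @ \oo --> (0 : R) /\
     (fun n => PrGnp p (fun G : {set 'I_n * 'I_n} => (satC4 G)%:R <=
        (3 * (1 + (1 - p) ^+ 3)) / (2 * (1 - (1 - p) ^+ 3)) * n%:R * (1 + eps n)))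
       @ \oo --> (1 : R))
  /\
  (p <= 1 - 1 / powR 7 (3^-1) ->
   forall s : nat, (0 < s)%N -> (2 * s%:R ^+ 2 + 1) * (1 - p) ^+ s < 1 ->
   (forall t : nat, (0 < t)%N -> (t < s)%N -> ~ ((2 * t%:R ^+ 2 + 1) * (1 - p) ^+ t < 1)) ->
   exists eps : nat -> R, eps @ \oo --> (0 : R) /\
     (fun n => PrGnp p (fun G : {set 'I_n * 'I_n} => (satC4 G)%:R <=
        ((s%:R + 1) / 2 + s%:R * (1 - p) ^+ s
           + s%:R * (1 - p) ^+ (2 * s) / (1 - (1 - p) ^+ s)) * n%:R * (1 + eps n)))
       @ \oo --> (1 : R)).
Proof.
have hmu m := mean_misses_geometric m hp0 hp1.
have Q1 : 0 < 1 - (1 - p) ^+ 3 by rewrite subr_gt0 exprn_ilt1 //; lra.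
split=> [_|hp s s0 hs _]; apply: (satC4_whp hp0 hp1 hmu).
  have -> : 3 * (1 + (1 - p) ^+ 3) / (2 * (1 - (1 - p) ^+ 3)) =
      3 / 2 + 3 * ((1 - p) ^+ 3 / (1 - (1 - p) ^+ 3)) by field; rewrite gt_eqF.
  exact: lexx.
have q0 : 0 < 1 - p by lra.
have q7 : 7^-1 <= (1 - p) ^+ 3.
  have r3 : powR 7 (3^-1) ^+ 3 = 7 :> R.
    by rewrite -powR_mulrn ?powR_ge0 // -powRrM mulVf // powRr1.
  have r0 : 0 < powR 7 (3^-1) :> R by rewrite powR_gt0.
  rewrite -r3 -exprVn; apply: lerXn2r; rewrite ?nnegrE ?invr_ge0 ?(ltW r0) ?(ltW q0) //.
  move: hp; rewrite div1r; lra.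
have sp : 2 <= s%:R * (1 - (1 - p)).
  by apply: threshold_degree hs => //; lra.
have qs : (1 - p) ^+ s < 1 by rewrite exprn_ilt1 ?ltW // ?gtrBl // -lt0n.
have t1 : 0 <= s%:R * (1 - p) ^+ s by rewrite mulr_ge0 ?exprn_ge0 ?(ltW q0).
have t2 : 0 <= s%:R * (1 - p) ^+ (2 * s) / (1 - (1 - p) ^+ s).
  by rewrite divr_ge0 ?mulr_ge0 ?exprn_ge0 ?subr_ge0 ?(ltW hp1) ?(ltW qs).
(* The nonnegative terms [t1] and [t2] are dropped, leaving a comparison with [(s + 1) / 2]. *)
suff : 3 * ((1 - p) ^+ 3 / (1 - (1 - p) ^+ 3)) <= s%:R / 2 - 1 by move: t1 t2; lra.
rewrite mulrA ler_pdivrMr //.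
have -> : 1 - (1 - p) ^+ 3 = p * (1 + (1 - p) + (1 - p) ^+ 2) by ring.
have spq : 1 - p <= (s%:R / 2 - 1) * p by move: sp; lra.
(* With [q = 1 - p], this uses [1 + q - 2 * q ^+ 2 = p * (2 * q + 1)], which is nonnegative. *)
apply: (@le_trans _ _ ((1 - p) * (1 + (1 - p) + (1 - p) ^+ 2))).
  have e1 : 0 <= (1 - p) * (p * (2 * (1 - p) + 1)) by rewrite !mulr_ge0 //; lra.
  rewrite !exprS expr0; move: e1; lra.
rewrite mulrA ler_wpM2r //.
have : 0 <= (1 - p) ^+ 2 by rewrite sqr_ge0.
lra.
Qed.
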